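(* Let $(\Omega,\Sigma,\mu)$ be a finite measure space, let $Z$ be a real Banach space and let $X\subseteq Z^*$ be a norm-closed subspace which is norming for $Z$. Suppose that the Banach space $X$ has Efremov's property $(\mathcal{E})$. If $\nu:\Sigma\to Z^*$ is a countably additive $\mu$-continuous vector measure such that $$\overline{\mathrm{co}(\mathcal{A}_\nu(A))}^{w^*}\cap X\neq\emptyset\quad\text{for every }A\in\Sigma\text{ with }\mu(A)>0,$$ then $\nu(\Sigma)\subseteq X$, i.e. $\nu(A)\in X$ for every $A\in\Sigma$.
   Context: A subspace $X\subseteq Z^*$ is norming for $Z$ if the formula $|||z|||=\sup\{\langle x,z\rangle: x\in B_X\}$ defines an equivalent norm on $Z$, where $B_X$ is the closed unit ball of $X$ and $\langle z^*,z\rangle$ denotes the evaluation of $z^*\in Z^*$ at $z\in Z$. A Banach space $X$ has Efremov's property $(\mathcal{E})$ if the weak$^*$-closure (in $X^*$) of any convex set $C\subseteq B_{X^*}$ consists of limits of weak$^*$-convergent sequences contained in $C$. Countable additivity and $\mu$-continuity of $\nu$ are with respect to the norm of $Z^*$ ($\mu$-continuous: $\|\nu(A)\|\to 0$ as $\mu(A)\to 0$). For $A\in\Sigma$ with $\mu(A)>0$, the average range is $$\mathcal{A}_\nu(A):=\Big\{\frac{\nu(B)}{\mu(B)}: B\in\Sigma,\ B\subseteq A,\ \mu(B)>0\Big\}.$$ $\mathrm{co}$ denotes convex hull and, for subsets of $Z^*$, $\overline{\,\cdot\,}^{w^*}$ denotes closure for the weak$^*$ topology $\sigma(Z^*,Z)$.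 *)

(* Defs.v *)
From HB Require Import structures.
From mathcomp Require Import all_boot all_order all_algebra.
From mathcomp Require Import all_classical all_reals all_analysis.

Set Implicit Arguments.
Unset Strict Implicit.
Unset Printing Implicit Defensive.

Import Order.TTheory GRing.Theory Num.Theory.
Import numFieldNormedType.Exports.

Local Open Scope classical_set_scope.
Local Open Scope ring_scope.

Definition closed_unit_ball (R : realType) (V : normedModType R) : set V :=
  [set x | `|x| <= 1].
Arguments closed_unit_ball {R} V.

(* [convex_lmodType V] is V seen as a convex space *)
Definition convex_hull (R : realType) (V : lmodType R) (A : set V) : set V :=
  smallest (@convex_set R V) A.

Section dual.
Context {R : realType} (V : normedModType R).

Definition dual_pred : {pred V -> R^o} :=
  fun f => `[< linear f /\ continuous f >].

Lemma dual_predP (f : V -> R^o) :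
  reflect (linear f /\ continuous f) (f \in dual_pred).
Proof. exact: asboolP. Qed.

Lemma dual_pred_submod_closed : submod_closed dual_pred.
Proof.
split.
  apply/dual_predP; split => [a x y /=|x]; last exact: cvg_cst.
  by rewrite scaler0 addr0.
move=> a f g /dual_predP[lf cf] /dual_predP[lg cg]; apply/dual_predP; split.
  move=> b x y /=; rewrite !fctE lf lg !scalerDr !scalerA (mulrC a b).
  by rewrite -!addrA; congr (_ + _); rewrite addrCA.
by move=> x; apply: cvgD; [apply: cvgZl_tmp; exact: cf|exact: cg].
Qed.

HB.instance Definition _ :=
  GRing.isSubmodClosed.Build R (V -> R^o) dual_pred dual_pred_submod_closed.

(* the topological dual: continuous linear functionals on V *)
Record dual : Type :=
  Dual { dual_fun :> V -> R^o ; _ : dual_fun \in dual_pred }.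

HB.instance Definition _ := [isSub for dual_fun].
HB.instance Definition _ := [Choice of dual by <:].
HB.instance Definition _ := [SubChoice_isSubLmodule of dual by <:].

Lemma dual_linear (f : dual) : linear f.
Proof. by have /dual_predP[] := valP f. Qed.

HB.instance Definition _ (f : dual) :=
  GRing.isLinear.Build R V R^o *:%R f (dual_linear f).

Lemma dual_continuous (f : dual) : continuous f.
Proof. by have /dual_predP[] := valP f. Qed.

Lemma dualP (f g : dual) : f =1 g -> f = g.
Proof. by move=> fg; apply/val_inj/funext. Qed.

Definition dual_norm (f : dual) : R :=
  sup [set `|f x| | x in closed_unit_ball V].

Lemma dual_norm_has_sup (f : dual) :
  has_sup [set `|f x| | x in closed_unit_ball V].
Proof.
split; first by exists `|f 0|, 0 => //=; rewrite /closed_unit_ball/= normr0.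
have /linear_boundedP : bounded_near f (nbhs (0 : V)).
  exact/linear_bounded_continuous/dual_continuous.
move=> /pinfty_ex_gt0[r r0 fr]; exists r => _ [x x1 <-].
by rewrite (le_trans (fr x))// ler_piMr// ltW.
Qed.

Lemma ler_dual_norm (f : dual) x : `|f x| <= dual_norm f * `|x|.
Proof.
have [->|x0] := eqVneq x 0; first by rewrite raddf0 !normr0 mulr0.
have nx0 : 0 < `|x| by rewrite normr_gt0.
rewrite -ler_pdivrMr//; apply: (sup_upper_bound (dual_norm_has_sup f)).
exists (`|x|^-1 *: x); first by rewrite /closed_unit_ball/= normfZV.
by rewrite linearZ/= normrM normfV normr_id mulrC.
Qed.

Lemma dual_norm_le (f : dual) (M : R) :
  (forall x, `|x| <= 1 -> `|f x| <= M) -> dual_norm f <= M.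
Proof.
move=> fM; apply: ge_sup; first by case: (dual_norm_has_sup f).
by move=> _ [x x1 <-]; exact: fM.
Qed.

Lemma dual_norm_ge0 (f : dual) : 0 <= dual_norm f.
Proof.
apply: (sup_upper_bound (dual_norm_has_sup f)).
by exists 0; rewrite ?raddf0 /closed_unit_ball /= normr0.
Qed.

Lemma ler_dual_norm1 (f : dual) x : `|x| <= 1 -> `|f x| <= dual_norm f.
Proof.
by move=> x1; rewrite (le_trans (ler_dual_norm f x))// ler_piMr// dual_norm_ge0.
Qed.

Lemma dual_normD (f g : dual) : dual_norm (f + g) <= dual_norm f + dual_norm g.
Proof.
apply: dual_norm_le => x x1.
by rewrite (le_trans (ler_normD _ _))// lerD// ler_dual_norm1.
Qed.

Lemma dual_normZ (a : R) (f : dual) : dual_norm (a *: f) = `|a| * dual_norm f.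
Proof.
have le b g : dual_norm (b *: g) <= `|b| * dual_norm g.
  apply: dual_norm_le => x x1.
  by rewrite /= normrM ler_wpM2l// ler_dual_norm1.
apply/eqP; rewrite eq_le le/=.
have [->|a0] := eqVneq a 0; first by rewrite normr0 mul0r dual_norm_ge0.
rewrite -ler_pdivlMl ?normr_gt0// -normfV.
by have := le a^-1 (a *: f); rewrite scalerA mulVf// scale1r.
Qed.

Lemma dual_norm0_eq0 (f : dual) : dual_norm f = 0 -> f = 0.
Proof.
move=> f0; apply: dualP => x; apply/eqP; rewrite -normr_le0.
by rewrite (le_trans (ler_dual_norm f x))// f0 mul0r.
Qed.

HB.instance Definition _ := @Lmodule_isNormed.Build R dual
  dual_norm dual_normD dual_normZ dual_norm0_eq0.

End dual.

Section weak_star.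
Context {R : realType} (V : normedModType R).

(* [dual V] with sigma(dual V, V): the topology induced by pointwise
   convergence on V *)
Definition weak_star : Type :=
  initial_topology (fun f : dual V => (f : {ptws V -> R^o})).

HB.instance Definition _ := Uniform.copy weak_star
  (initial_topology (fun f : dual V => (f : {ptws V -> R^o}))).

Definition weak_star_closure (C : set (dual V)) : set (dual V) :=
  closure (C : set weak_star).

Definition weak_star_cvg (u : nat -> dual V) (f : dual V) : Prop :=
  (u : nat -> weak_star) @ \oo --> (f : weak_star).

Lemma weak_star_cvgP (u : nat -> dual V) (f : dual V) :
  weak_star_cvg u f <-> forall x, u n x @[n --> \oo] --> f x.
Proof.
have -> : (forall x, u n x @[n --> \oo] --> f x) <->
    {ptws, (fun n => u n : V -> R^o) @ \oo --> (f : V -> R^o)}.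
  by rewrite pointwise_cvgP.
split => uf.
  apply: (@cvg_comp _ _ _ (u : nat -> weak_star)
    (fun g : weak_star => (g : dual V) : {ptws V -> R^o}));
    first exact: uf.
  exact: initial_continuous.
move=> A [_ [[B oB <-] Bf BA]].
by apply: (filterS BA); apply: uf; exact: open_nbhs_nbhs.
Qed.

End weak_star.

Section subspace_normed.
Context {R : realType} {V : normedModType R} (X : submodClosed V).

(* the linear subspace X of V as a normed space, with the norm inherited
   from V *)
Record normed_subspace : Type :=
  NormedSubspace { subspace_val :> V ; _ : subspace_val \in X }.

HB.instance Definition _ := [isSub for subspace_val].
HB.instance Definition _ := [Choice of normed_subspace by <:].
HB.instance Definition _ := [SubChoice_isSubLmodule of normed_subspace by <:].

Definition subspace_norm (x : normed_subspace) : R := `|subspace_val x|.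

Lemma subspace_normD x y :
  subspace_norm (x + y) <= subspace_norm x + subspace_norm y.
Proof. exact: ler_normD. Qed.

Lemma subspace_normZ (a : R) x :
  subspace_norm (a *: x) = `|a| * subspace_norm x.
Proof. exact: normrZ. Qed.

Lemma subspace_norm0_eq0 x : subspace_norm x = 0 -> x = 0.
Proof. by move=> /normr0_eq0 x0; exact/val_inj. Qed.

HB.instance Definition _ := @Lmodule_isNormed.Build R normed_subspace
  subspace_norm subspace_normD subspace_normZ subspace_norm0_eq0.

End subspace_normed.

Definition is_norm (R : realType) (V : lmodType R) (p : V -> R) : Prop :=
  [/\ forall x y, p (x + y) <= p x + p y,
      forall (a : R) x, p (a *: x) = `|a| * p x
    & forall x, p x = 0 -> x = 0].

Definition equivalent_norm (R : realType) (V : normedModType R)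
    (p : V -> R) : Prop :=
  is_norm p /\
  exists a b : R, [/\ 0 < a, 0 < b & forall x, a * `|x| <= p x <= b * `|x|].

(* The set under [sup] contains 0 and is bounded by `|z|. *)
Definition norming (R : realType) (Z : normedModType R)
    (X : submodClosed (dual Z)) : Prop :=
  equivalent_norm (fun z : Z =>
    sup [set subspace_val x z | x in closed_unit_ball (normed_subspace X)]).

Definition efremov (R : realType) (V : normedModType R) : Prop :=
  forall C : set (dual V), convex_set (C : set (convex_lmodType (dual V))) ->
    C `<=` closed_unit_ball (dual V) ->
    forall f, weak_star_closure C f ->
      exists u : nat -> dual V, (forall n, C (u n)) /\ weak_star_cvg u f.

Section vector_measure.
Context {R : realType} {d : measure_display} {T : measurableType d}.
Context {V : normedModType R}.

(* The value of nu on non-measurable sets is irrelevant. The convergence is in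
   norm; applied to the empty sets it gives nu set0 = 0, so that finite
   additivity is included. *)
Definition countably_additive (nu : set T -> V) : Prop :=
  forall F : nat -> set T, (forall i, measurable (F i)) -> trivIset setT F ->
    (fun n => \sum_(0 <= i < n) nu (F i)) @ \oo --> nu (\bigcup_i F i).

Definition mu_continuous (mu : set T -> \bar R) (nu : set T -> V) : Prop :=
  forall e : R, 0 < e -> exists2 delta : R, 0 < delta &
    forall A, measurable A -> (mu A < delta%:E)%E -> `|nu A| < e.

(* [fine] is harmless for a finite measure *)
Definition average_range (mu : set T -> \bar R) (nu : set T -> V)
    (A : set T) : set V :=
  [set (fine (mu B))^-1 *: nu B |
    B in [set B | [/\ measurable B, B `<=` A & (0 < mu B)%E]]].

End vector_measure.

(* Main.v *)
From HB Require Import structures.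
Require Import Defs.
From mathcomp Require Import all_boot all_order all_algebra.
From mathcomp Require Import all_classical all_reals all_analysis.
From mathcomp Require Import measurable_realfun ring lra.

Set Implicit Arguments.
Unset Strict Implicit.
Unset Printing Implicit Defensive.

Import Order.TTheory GRing.Theory Num.Theory.
Import numFieldNormedType.Exports.

Local Open Scope classical_set_scope.
Local Open Scope ring_scope.

(** Suppose that some value [y = nu A] lies outside [X].  Since [X] is closed,
    [y] is at positive distance [r] from it, and Helly's theorem ([helly])
    gives, for any finitely many functionals in [X], a vector of the unit ball
    of [Z] at which all of them vanish while [y] is at least [r / 2].  Seen as
    functionals on [X], these vectors form a bounded convex set having [0] in
    its weak* closure, so property (E) provides a sequence [z n] in the unit
    ball of [Z] with [r / 2 <= nu A (z n)] that tends to [0] pointwise on [X]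
    ([efremov_sequence]).

    Each scalar measure [B |-> nu B z] has a density with respect to [mu]
    ([density_exists]).  The densities of the [z n] may oscillate, but convex
    combinations tame them: by the Komlos-type selection
    [rapidly_cauchy_selection] there are [h k] in the convex hull of the tail
    of [z] from [k] on, with densities [g k] that form a rapidly Cauchy sequence
    in measure.  As [nu A (h k) >= r / 2] and [nu] is [mu]-continuous, the sets
    where [g k] is not small have measure bounded below, so one set [B] of
    positive measure and one constant [c > 0] satisfy [c <= g k] on [B] for all
    large [k] ([tail_densities_lower_bound]).

    All averages of [nu] over subsets of [B], hence all [x] in the weak* closed
    convex hull of the average range over [B], then satisfy [c <= x (h k)]
    ([average_range_closed_hull_ge]).  If such an [x] belonged to [X] then
    [x (h k)] would tend to [0], because [x (z n)] does
    ([null_on_tail_hulls]). *)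

(** * Convex sets and convex hulls *)

Section convexity.
Context {R : realType} {V : lmodType R}.
Implicit Types S A : set V.

Lemma convex_setP S : convex_set (S : set (convex_lmodType V)) <->
  forall (a b : R) x y, 0 <= a -> 0 <= b -> a + b = 1 ->
    S x -> S y -> S (a *: x + b *: y).
Proof.
split=> [cS a b x y a0 b0 ab Sx Sy|cS x y l /set_mem Sx /set_mem Sy].
  have a1 : a <= 1 by rewrite -ab lerDl.
  have /set_mem := cS x y (Itv01 a0 a1) (mem_set Sx) (mem_set Sy).
  by have -> : b = 1 - a by rewrite -ab addrC addKr.
apply/mem_set/cS => //; last by rewrite addrC subrK.
by rewrite subr_ge0.
Qed.

Lemma convex_hull_convex A :
  convex_set (convex_hull A : set (convex_lmodType V)).
Proof.
apply/convex_setP => a b x y a0 b0 ab Ax Ay S SA; have [cS _] := SA.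
by move/convex_setP: cS; apply=> //; [exact: Ax|exact: Ay].
Qed.

Definition tail_hull (u : nat -> V) (k : nat) : set V :=
  convex_hull (u @` [set n | (k <= n)%N]).

Lemma tail_hull_sub (u : nat -> V) k S :
  convex_set (S : set (convex_lmodType V)) ->
  (forall n, (k <= n)%N -> S (u n)) -> tail_hull u k `<=` S.
Proof. by move=> cS uS; apply: smallest_sub => // _ [n /uS Sn <-]. Qed.

Lemma tail_hull_mem (u : nat -> V) k n : (k <= n)%N -> tail_hull u k (u n).
Proof. by move=> kn S [_]; apply; exists n. Qed.

Lemma tail_hullS (u : nat -> V) k : tail_hull u k.+1 `<=` tail_hull u k.
Proof.
apply: tail_hull_sub; first exact: convex_hull_convex.
by move=> n /ltnW; exact: tail_hull_mem.
Qed.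

End convexity.

Lemma dual_funZ {R : realType} {Z : normedModType R} (f : dual Z) a z :
  f (a *: z) = a * f z.
Proof. exact: linearZ. Qed.

Lemma dual_funD {R : realType} {Z : normedModType R} (f : dual Z) u v :
  f (u + v) = f u + f v.
Proof. exact: raddfD. Qed.

Lemma convex_slab {R : realType} {Z : normedModType R} (x : dual Z) (e : R) :
  convex_set ([set z | `|x z| <= e] : set (convex_lmodType Z)).
Proof.
apply/convex_setP => a b y z a0 b0 ab /= ya za.
rewrite dual_funD !dual_funZ (le_trans (ler_normD _ _))// !normrM.
rewrite (ger0_norm a0) (ger0_norm b0).
have -> : e = a * e + b * e by rewrite -mulrDl ab mul1r.
by rewrite lerD// ler_wpM2l.
Qed.

Lemma convex_ball_halfspace {R : realType} {Z : normedModType R} (y : dual Z)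
    (c : R) :
  convex_set ([set z | `|z| <= 1 /\ c <= y z] : set (convex_lmodType Z)).
Proof.
apply/convex_setP => a b u v a0 b0 ab /= [u1 cu] [v1 cv]; split.
  rewrite (le_trans (ler_normD _ _))// !normrZ.
  by rewrite (ger0_norm a0) (ger0_norm b0) -ab lerD// ler_piMr.
rewrite dual_funD !dual_funZ.
have -> : c = a * c + b * c by rewrite -mulrDl ab mul1r.
by rewrite lerD// ler_wpM2l.
Qed.

(** * Helly's theorem for a subspace of the dual *)

Section helly.
Context {R : realType} {Z : normedModType R} (X : submodClosed (dual Z)).
Implicit Types (y x : dual Z) (N : set Z) (r : R).

(** For [N = setT] this says that [y] is at distance at least [r] from [X]; in
    general it bounds below the norms of the restrictions to [N] of all the
    [y - x].  The strict bounds [c < r] stand for suprema that need not be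
    attained. *)
Definition far_on N y r : Prop := forall x, x \in X ->
  forall c, c < r -> exists z, [/\ N z, `|z| <= 1 & c < (y - x) z].

(** This is the one-dimensional step of the Hahn-Banach theorem in disguise.  If
    the restriction of [w = y - x] to [N `&` ker x1] had norm at most [c < r],
    then [w] could be corrected by a multiple of [x1], hence without leaving the
    coset [y + X], into a functional of norm at most [c] on all of [N]. *)
Lemma far_on_kernel N y r x1 : N 0 ->
  (forall a u v, N u -> N v -> N (a *: u + v)) -> x1 \in X ->
  far_on N y r -> far_on (N `&` [set z | x1 z = 0]) y r.
Proof.
move=> N0 Nlin X1 farN x Xx c cr; apply: contrapT => noz.
have le0 z : N z -> x1 z = 0 -> (y - x) z <= c * `|z|.
  move=> Nz x1z; have [->|z0] := eqVneq z 0.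
    by rewrite raddf0 normr0 mulr0.
  rewrite -ler_pdivrMr ?normr_gt0// leNgt; apply/negP => cz; apply: noz.
  exists (`|z|^-1 *: z); split; last by rewrite dual_funZ mulrC.
  - split; last by rewrite /= dual_funZ x1z mulr0.
    by rewrite -[_ *: _]addr0; exact: Nlin.
  - by rewrite normfZV.
have c0 : 0 <= c.
  rewrite leNgt; apply/negP => c0; apply: noz; exists 0.
  by rewrite raddf0 normr0 ler01 /= raddf0.
(* The admissible multiples [a] of [x1] are those between all [w z - c * |z|]
   and all [w z + c * |z|] with [x1 z = 1]; the least one is taken. *)
pose L := [set (y - x) z - c * `|z| | z in [set z | N z /\ x1 z = 1]].
have ubL z : N z -> x1 z = 1 -> ubound L ((y - x) z + c * `|z|).
  move=> Nz x1z _ [u [Nu x1u] <-].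
  have := le0 (-1 *: z + u) (Nlin _ _ _ Nz Nu).
  rewrite !dual_funD !dual_funZ x1u x1z mulN1r addNr mulN1r => /(_ erefl).
  have := ler_wpM2l c0 (ler_normD (-1 *: z) u); rewrite normrZ normrN1 mul1r.
  by move=> h1 h2; lra.
have [a Pa] : exists a, forall z, N z -> x1 z = 1 ->
    (y - x) z - c * `|z| <= a <= (y - x) z + c * `|z|.
  exists (sup L) => z Nz x1z; apply/andP; split.
    apply: ub_le_sup; last by exists z.
    by exists ((y - x) z + c * `|z|); exact: ubL.
  apply: ge_sup; last exact: ubL.
  by exists ((y - x) z - c * `|z|), z.
have Xx' : x + a *: x1 \in X by rewrite rpredD// rpredZ.
have [z [Nz z1]] := farN _ Xx' _ cr; apply/negP; rewrite -leNgt.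
have zE : (y - (x + a *: x1)) z = (y - x) z - a * x1 z.
  by rewrite opprD addrA.
rewrite zE; apply: (@le_trans _ _ (c * `|z|)); last by rewrite ler_piMr.
have [x1z|x1z] := eqVneq (x1 z) 0.
  by rewrite x1z mulr0 subr0; exact: le0.
set w := (x1 z)^-1 *: z.
have Nw : N w by rewrite /w -[_ *: _]addr0; exact: Nlin.
have x1w : x1 w = 1 by rewrite /w dual_funZ mulVf.
have wE : z = x1 z *: w by rewrite /w scalerA divff// scale1r.
have /andP[aw1 aw2] := Pa _ Nw x1w.
have -> : (y - x) z = x1 z * (y - x) w by rewrite {1}wE dual_funZ.
have -> : `|z| = `|x1 z| * `|w| by rewrite {1}wE normrZ.
move: (x1 z) ((y - x) w) `|w| aw1 aw2 => t v n aw1 aw2.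
have [t0|t0] := leP 0 t.
  rewrite (ger0_norm t0) -subr_ge0.
  have -> : c * (t * n) - (t * v - a * t) = t * (a - (v - c * n)) by ring.
  by rewrite mulr_ge0// subr_ge0.
rewrite (ltr0_norm t0) -subr_ge0.
have -> : c * (- t * n) - (t * v - a * t) = - t * ((v + c * n) - a) by ring.
by rewrite mulr_ge0 ?subr_ge0// oppr_ge0 ltW.
Qed.

Lemma helly y r (s : seq (dual Z)) : {subset s <= X} -> far_on setT y r ->
  forall c, c < r ->
  exists z, [/\ `|z| <= 1, c < y z & forall x, x \in s -> x z = 0].
Proof.
move=> sX fary c cr.
suff [N [N0 Nlin farN Ns]] : exists N, [/\ N 0,
    forall a u v, N u -> N v -> N (a *: u + v), far_on N y r &
    forall z, N z -> forall x, x \in s -> x z = 0].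
  have [z [Nz z1]] := farN _ (rpred0 X) _ cr; rewrite subr0 => cz.
  by exists z; split => // x; exact: Ns.
elim: s sX => [|x s IH] sX; first by exists setT.
have [|N [N0 Nlin farN Ns]] := IH.
  by move=> u us; apply: sX; rewrite inE us orbT.
exists (N `&` [set z | x z = 0]); split => /=.
- by rewrite raddf0.
- move=> a u v [Nu xu] [Nv xv]; split; first exact: Nlin.
  by rewrite dual_funD dual_funZ xu xv mulr0 addr0.
- by apply: far_on_kernel => //; apply: sX; rewrite inE eqxx.
- move=> z [Nz xz] u; rewrite inE => /predU1P[->//|]; exact: Ns.
Qed.

Lemma far_onT y : closed [set` X] -> y \notin X ->
  exists2 r : R, 0 < r & far_on setT y r.
Proof.
move=> clX yX.
have : nbhs y (~` [set` X]).
  by apply: open_nbhs_nbhs; split; [exact: closed_openC|exact/negP].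
move=> /nbhs_ballP[r/= r0 ballX]; exists r => // x Xx c cr.
apply: contrapT => noz.
have : `|y - x| <= c.
  apply: dual_norm_le => z z1; rewrite ler_norml; apply/andP; split.
    rewrite leNgt; apply/negP => zc; apply: noz; exists (- z).
    by rewrite normrN raddfN/=; split => //; rewrite ltrNr.
  by rewrite leNgt; apply/negP => zc; apply: noz; exists z.
move=> /le_lt_trans/(_ cr) yx; exact: (ballX x).
Qed.

End helly.

(** * Weak* topology and property (E) *)

Section weak_star_topology.
Context {R : realType} {V : normedModType R}.

Lemma weak_star_filter_cvg (F : set_system (dual V)) (f : dual V) :
  Filter F -> (forall x, g x @[g --> F] --> f x) ->
  (F : set_system (weak_star V)) --> (f : weak_star V).
Proof.
move=> FF Ff.
have cF : {ptws, (fun g : dual V => (g : V -> R^o)) @ F --> (f : V -> R^o)}.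
  by apply/pointwise_cvgP => x; exact: Ff.
move=> A [_ [[B oB <-] Bf BA]].
by apply: (filterS BA); apply: cF; exact: open_nbhs_nbhs.
Qed.

Lemma weak_star_eval_continuous (x : V) :
  continuous (fun f : weak_star V => (f : dual V) x).
Proof.
move=> f.
have fi : {ptws, (fun g : weak_star V => ((g : dual V) : V -> R^o)) @ nbhs f
    --> ((f : dual V) : V -> R^o)}.
  exact: (@initial_continuous _ _
    (fun g : dual V => (g : {ptws V -> R^o})) f).
by move/pointwise_cvgP : fi => /(_ x).
Qed.

End weak_star_topology.

Section evaluation.
Context {R : realType} {Z : normedModType R} (X : submodClosed (dual Z)).

Definition eval_fun (z : Z) (x : normed_subspace X) : R^o := subspace_val x z.

Lemma eval_fun_linear z : linear (eval_fun z).
Proof. by []. Qed.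

HB.instance Definition _ z := GRing.isLinear.Build R (normed_subspace X) R^o
  *:%R (eval_fun z) (eval_fun_linear z).

Lemma eval_dual_pred z : eval_fun z \in @dual_pred R (normed_subspace X).
Proof.
apply/dual_predP; split; first exact: eval_fun_linear.
apply/linear_bounded_continuous/linear_boundedP.
near=> r => x; rewrite (le_trans (ler_dual_norm _ _))// mulrC.
rewrite ler_wpM2r ?dual_norm_ge0//; near: r; exact: nbhs_pinfty_ge.
Unshelve. all: by end_near. Qed.

Definition eval_on (z : Z) : dual (normed_subspace X) :=
  Dual (eval_dual_pred z).

(** Property (E) is applied to the image of [C] in the dual of [X].  The sets
    of vectors of [C] killed by a given finite part of [X] form a filter base,
    whose image converges pointwise, that is weak*, to [0]; so [0] is in the
    weak* closure of the image of [C]. *)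
Lemma efremov_sequence (C : set Z) : efremov (normed_subspace X) ->
  C `<=` closed_unit_ball Z ->
  convex_set (C : set (convex_lmodType Z)) ->
  (forall s : seq (dual Z), {subset s <= X} ->
    exists2 z, C z & forall x, x \in s -> x z = 0) ->
  exists z : nat -> Z, (forall n, C (z n)) /\
    forall x, x \in X -> x (z n) @[n --> \oo] --> (0 : R).
Proof.
move=> ef C1 /convex_setP Ccvx Cker.
have conv : convex_set (eval_on @` C : set (convex_lmodType (dual _))).
  apply/convex_setP => a b _ _ a0 b0 ab [u Cu <-] [v Cv <-].
  exists (a *: u + b *: v); first exact: Ccvx.
  by apply: dualP => x /=; rewrite /eval_fun dual_funD !dual_funZ.
have ball : eval_on @` C `<=` closed_unit_ball (dual (normed_subspace X)).
  move=> _ [z Cz <-]; apply: dual_norm_le => x x1.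
  apply: (le_trans (ler_dual_norm (subspace_val x) z)).
  rewrite mulr_ile1 ?dual_norm_ge0//; last exact: C1.
have cl0 : weak_star_closure (eval_on @` C) 0.
  pose B (s : seq (normed_subspace X)) :=
    C `&` [set z | forall x : normed_subspace X,
                     x \in s -> subspace_val x z = 0].
  pose F := filter_from setT B.
  have FF : Filter F.
    apply: filter_from_filter; first by exists [::].
    move=> s t _ _; exists (s ++ t) => // z [Cz st]; split; split => //= x xs;
      by apply: st; rewrite mem_cat xs ?orbT.
  have cF : (eval_on @ F : set_system (weak_star _)) -->
      (0 : weak_star (normed_subspace X)).
    apply: weak_star_filter_cvg => x A A0.
    exists [:: x] => // z [Cz /(_ x)]; rewrite inE eqxx => /(_ isT) xz /=.
    by rewrite /eval_fun xz; exact: nbhs_singleton A0.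
  move=> A /cF[s _ BA].
  have [|z Cz sz] := Cker (map (@subspace_val _ _ X) s).
    by move=> _ /mapP[x _ ->]; exact: valP.
  exists (eval_on z); split; first by exists z.
  by apply: BA; split => // x xs; apply: sz; exact: map_f.
have [u [Cu u0]] := ef _ conv ball _ cl0.
have /choice[z Pz] n : exists z, C z /\ eval_on z = u n.
  by have [z Cz zE] := Cu n; exists z.
exists z; split => [n|x Xx]; first by have [] := Pz n.
have /weak_star_cvgP/(_ (NormedSubspace Xx)) := u0.
suff -> : (fun n => u n (NormedSubspace Xx)) = (fun n => x (z n)) by [].
by apply/funext => n; have [_ <-] := Pz n.
Qed.

End evaluation.

(** * A strictly convex function of linear growth *)

Section smooth_abs.
Context {R : realType}.
Implicit Types x y : R.

(** Linear growth makes [smooth_abs \o g] integrable for integrable [g], and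
    strict convexity makes near-minimizers of its integral close to each other,
    as the parallelogram identity does for the square. *)
Definition smooth_abs x : R := Num.sqrt (1 + x ^+ 2).

Definition midpoint_gap x y : R :=
  smooth_abs x + smooth_abs y - 2 * smooth_abs ((x + y) / 2).

Lemma sqr_smooth_abs x : smooth_abs x ^+ 2 = 1 + x ^+ 2.
Proof. by rewrite sqr_sqrtr// addr_ge0// sqr_ge0. Qed.

Lemma smooth_abs_ge1 x : 1 <= smooth_abs x.
Proof. by rewrite -[leLHS]sqrtr1 ler_wsqrtr// lerDl sqr_ge0. Qed.

Lemma smooth_abs_ge0 x : 0 <= smooth_abs x.
Proof. exact: sqrtr_ge0. Qed.

Lemma ler_smooth_abs x : smooth_abs x <= 1 + `|x|.
Proof.
rewrite -(@ler_pXn2r _ 2)// ?nnegrE ?smooth_abs_ge0 ?addr_ge0//.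
rewrite sqr_smooth_abs -(real_normK (num_real x)).
by have := normr_ge0 x; nra.
Qed.

(** The gap is rationalized twice: multiplying [a + b - 2 * m] by its conjugate
    leaves [2 * (a * b - (1 + x * y))], and multiplying this by the conjugate
    of its last factor leaves [2 * (x - y) ^+ 2]. *)
Lemma midpoint_gap_factor x y (a := smooth_abs x) (b := smooth_abs y)
    (m := smooth_abs ((x + y) / 2)) :
  midpoint_gap x y * ((a + b + 2 * m) * (a * b + 1 + x * y)) =
  2 * (x - y) ^+ 2.
Proof.
have a2 : a ^+ 2 = 1 + x ^+ 2 by exact: sqr_smooth_abs.
have b2 : b ^+ 2 = 1 + y ^+ 2 by exact: sqr_smooth_abs.
have m2 : m ^+ 2 = 1 + ((x + y) / 2) ^+ 2 by exact: sqr_smooth_abs.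
rewrite /midpoint_gap -/a -/b -/m.
transitivity ((a ^+ 2 + b ^+ 2 + 2 * a * b - 4 * m ^+ 2) * (a * b + 1 + x * y)).
  by ring.
rewrite a2 b2 m2.
transitivity (2 * (a ^+ 2 * b ^+ 2 - (1 + x * y) ^+ 2)); first by field.
by rewrite a2 b2; ring.
Qed.

Lemma smooth_abs_prod x y : `|x * y| < smooth_abs x * smooth_abs y.
Proof.
rewrite -(@ltr_pXn2r _ 2)// ?nnegrE ?mulr_ge0 ?smooth_abs_ge0//.
rewrite real_normK ?num_real// !exprMn !sqr_smooth_abs.
by have := sqr_ge0 x; have := sqr_ge0 y; nra.
Qed.

Lemma midpoint_gap_ge0 x y : 0 <= midpoint_gap x y.
Proof.
have a1 := smooth_abs_ge1 x; have b1 := smooth_abs_ge1 y.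
have m1 := smooth_abs_ge1 ((x + y) / 2).
have := smooth_abs_prod x y; rewrite ltr_norml => /andP[xy _].
have p : 0 < (smooth_abs x + smooth_abs y + 2 * smooth_abs ((x + y) / 2)) *
    (smooth_abs x * smooth_abs y + 1 + x * y).
  by rewrite mulr_gt0//; lra.
by rewrite -(pmulr_lge0 _ p) midpoint_gap_factor mulr_ge0// sqr_ge0.
Qed.

(** Quantitative strict convexity on bounded sets.  By [midpoint_gap_factor]
    the gap is [2 * (x - y) ^+ 2] divided by a product that is at most
    [4 / r * (3 / r ^+ 2)] when [smooth_abs] is at most [r^-1] at both points.
    A single parameter measures both the distance and the bound, since both
    will be powers of [2]. *)
Lemma midpoint_gap_lb x y r : 0 < r -> smooth_abs x <= r^-1 ->
  smooth_abs y <= r^-1 -> r <= `|x - y| -> r ^+ 5 / 6 <= midpoint_gap x y.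
Proof.
move=> r0 xr yr rxy.
have := midpoint_gap_factor x y; have := midpoint_gap_ge0 x y.
have a1 := smooth_abs_ge1 x; have b1 := smooth_abs_ge1 y.
have m1 := smooth_abs_ge1 ((x + y) / 2).
have := smooth_abs_prod x y; rewrite ltr_norml => /andP[xy1 xy2].
move=> g0 gE.
have rxy2 : r ^+ 2 <= (x - y) ^+ 2.
  by rewrite -(real_normK (num_real (x - y))) lerXn2r ?nnegrE// ltW.
have mr : 2 * smooth_abs ((x + y) / 2) <= smooth_abs x + smooth_abs y.
  by rewrite -subr_ge0.
have K0 : 0 < r^-1 by rewrite invr_gt0.
have ab : smooth_abs x * smooth_abs y <= r^-1 * r^-1.
  by rewrite ler_pM// smooth_abs_ge0.
have ab1 : 1 <= r^-1 * r^-1 by nra.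
have : 2 * r ^+ 2 <= midpoint_gap x y * ((4 * r^-1) * (3 * r^-1 * r^-1)).
  apply: (@le_trans _ _ (2 * (x - y) ^+ 2)); first by rewrite ler_pM2l.
  rewrite -gE ler_wpM2l// ler_pM//; lra.
have -> : 4 * r^-1 * (3 * r^-1 * r^-1) = 12 / r ^+ 3 by field; rewrite gt_eqF.
rewrite [leRHS]mulrA ler_pdivlMr ?exprn_gt0// => h.
rewrite ler_pdivrMr//; move: h; have -> : r ^+ 5 = r ^+ 2 * r ^+ 3 by ring.
by move=> h; lra.
Qed.

End smooth_abs.

(** * Convex combinations that are Cauchy in measure *)

Section minimizing_sequence.
Context {d : measure_display} {T : measurableType d} {R : realType}.
Variable mu : {finite_measure set T -> \bar R}.
Implicit Types f g : T -> R.

Local Notation integrableR g := (mu.-integrable setT (EFin \o g)).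

Lemma chebyshev_Rintegral (c : R) g : 0 < c -> integrableR g ->
  (forall t, 0 <= g t) ->
  (mu [set t | (c <= g t)%R] <= (\int[mu]_t g t / c)%:E)%E.
Proof.
move=> c0 ig g0.
have := @le_integral_comp_abse _ _ _ mu setT measurableT (EFin \o g) c id
  (@measurable_id _ _ _) (fun _ => id) (fun _ _ _ _ => id) (measurable_int _ ig)
  c0.
rewrite setTI /=.
under eq_set do rewrite lee_fin ger0_norm//.
under eq_integral do rewrite ger0_norm//.
have -> : (\int[mu]_x (g x)%:E = (\int[mu]_t g t)%:E)%E.
  by rewrite fineK//; exact: integrable_fin_num.
have : mu [set t | c <= g t] \is a fin_num.
  apply: fin_num_measure; rewrite -[X in measurable X]setTI.
  apply: measurable_fun_le => //; apply/measurable_EFinP.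
  exact: measurable_int ig.
by move=> /fineK <-; rewrite -EFinM !lee_fin ler_pdivlMr// mulrC.
Qed.

Lemma measurable_smooth_abs : measurable_fun setT (@smooth_abs R).
Proof.
apply: (@measurableT_comp _ _ _ _ _ _ (@Num.sqrt R)).
  apply: continuous_measurable_fun; exact: sqrt_continuous.
by apply: measurable_funD => //; exact: measurable_funX.
Qed.

Lemma integrable_cst1 : integrableR (cst 1 : T -> R).
Proof. exact: finite_measure_integrable_cst. Qed.

Lemma integrable_smooth_abs g : integrableR g -> integrableR (smooth_abs \o g).
Proof.
move=> ig.
apply: (@le_integrable _ _ _ mu setT measurableT _
    (EFin \o (fun t => 1 + `|g t|))).
- apply/measurable_EFinP; apply: measurableT_comp measurable_smooth_abs _.
  exact/measurable_EFinP/(measurable_int mu ig).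
- move=> t _ /=; rewrite lee_fin ger0_norm ?smooth_abs_ge0// ger0_norm.
    exact: ler_smooth_abs.
  by rewrite addr_ge0.
- have -> : EFin \o (fun t => 1 + `|g t|) =
      (EFin \o cst 1) \+ (abse \o (EFin \o g)) by [].
  apply: integrableD => //; first exact: integrable_cst1.
  exact: integrable_abse.
Qed.

Lemma integrable_midpoint f g : integrableR f -> integrableR g ->
  integrableR (fun t => (f t + g t) / 2).
Proof.
move=> fi gi.
have -> : EFin \o (fun t => (f t + g t) / 2) =
    (fun t => (2^-1)%:E * ((EFin \o f) t + (EFin \o g) t))%E.
  by apply/funext => t /=; rewrite mulrC.
by apply: integrableZl => //; exact: integrableD.
Qed.

Lemma Rintegral_smooth_abs_le g : integrableR g ->
  \int[mu]_t smooth_abs (g t) <= fine (mu setT) + \int[mu]_t `|g t|.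
Proof.
move=> ig.
have ia : integrableR (fun t => `|g t|) by exact: integrable_abse ig.
have i1 := integrable_cst1.
rewrite -[X in _ <= X + _]mul1r -Rintegral_cst// -RintegralD//.
apply: le_Rintegral => //; first exact: integrable_smooth_abs.
- exact: (integrableD measurableT i1 ia).
- by move=> t _; exact: ler_smooth_abs.
Qed.

Lemma integrable_midpoint_gap f g : integrableR f -> integrableR g ->
  integrableR (fun t => midpoint_gap (f t) (g t)).
Proof.
move=> fi gi.
have mi := integrable_smooth_abs (integrable_midpoint fi gi).
have := integrableB measurableT
  (integrableD measurableT (integrable_smooth_abs fi)
    (integrable_smooth_abs gi))
  (integrableZl measurableT 2 mi).
by apply: eq_integrable.
Qed.

Lemma Rintegral_midpoint_gap f g : integrableR f -> integrableR g ->
  \int[mu]_t midpoint_gap (f t) (g t) =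
  \int[mu]_t smooth_abs (f t) + \int[mu]_t smooth_abs (g t)
  - 2 * \int[mu]_t smooth_abs ((f t + g t) / 2).
Proof.
move=> fi gi.
have sf := integrable_smooth_abs fi; have sg := integrable_smooth_abs gi.
have mi := integrable_smooth_abs (integrable_midpoint fi gi).
rewrite RintegralB//.
- by rewrite RintegralD// RintegralZl.
- exact: (integrableD measurableT sf sg).
- exact: (integrableZl measurableT 2 mi).
Qed.

(** Outside the two sets where [smooth_abs] exceeds [r^-1], which are small
    because of the bound [B] on the integrals, a distance of at least [r] forces
    a gap of at least [r ^+ 5 / 6]. *)
Lemma measure_far_le (B r : R) f g : 0 < r -> integrableR f -> integrableR g ->
  \int[mu]_t smooth_abs (f t) <= B -> \int[mu]_t smooth_abs (g t) <= B ->
  \int[mu]_t midpoint_gap (f t) (g t) <= r ^+ 6 / 6 ->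
  (mu [set t | (r <= `|f t - g t|)%R] <= ((1 + 2 * B) * r)%:E)%E.
Proof.
move=> r0 fi gi fB gB gap.
have mle (h : T -> R) c : integrableR h -> measurable [set t | c <= h t].
  move=> ih; rewrite -[X in measurable X]setTI.
  apply: measurable_fun_le => //; apply/measurable_EFinP.
  exact: measurable_int ih.
have sf := integrable_smooth_abs fi; have sg := integrable_smooth_abs gi.
have ig := integrable_midpoint_gap fi gi.
have dfg : integrableR (fun t => `|f t - g t|).
  exact: integrable_abse (integrableB measurableT fi gi).
set A := [set t | r ^+ 5 / 6 <= midpoint_gap (f t) (g t)].
set F := [set t | r^-1 <= smooth_abs (f t)].
set G := [set t | r^-1 <= smooth_abs (g t)].
have mA : measurable A by exact: mle.
have mF : measurable F by exact: mle sf.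
have mG : measurable G by exact: mle sg.
apply: (@le_trans _ _ (mu (A `|` F `|` G))).
  apply: le_measure; rewrite ?inE; first exact: (mle _ r dfg).
    by apply: measurableU => //; exact: measurableU.
  move=> t /= rt; have [Ft|Ft] := leP r^-1 (smooth_abs (f t)).
    by left; right.
  have [Gt|Gt] := leP r^-1 (smooth_abs (g t)); first by right.
  by left; left; rewrite /A/= midpoint_gap_lb// ltW.
apply: (le_trans (measureU2 mu (measurableU _ _ mA mF) mG)).
apply: (@le_trans _ _ ((r + B * r)%:E + (B * r)%:E)%E); last first.
  by rewrite -EFinD lee_fin; lra.
have r'0 : 0 < r^-1 by rewrite invr_gt0.
have sB h : integrableR h -> \int[mu]_t smooth_abs (h t) <= B ->
    (mu [set t | (r^-1 <= smooth_abs (h t))%R] <= (B * r)%:E)%E.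
  move=> ih hB.
  have := chebyshev_Rintegral r'0 (integrable_smooth_abs ih)
    (fun t => smooth_abs_ge0 (h t)).
  by move/le_trans; apply; rewrite lee_fin invrK ler_pM2r.
apply: leeD; last exact: sB.
apply: (le_trans (measureU2 mu mA mF)); rewrite EFinD.
apply: leeD; last exact: sB.
have r5 : 0 < r ^+ 5 / 6 by rewrite divr_gt0 ?exprn_gt0.
apply: (le_trans (chebyshev_Rintegral r5 ig (fun t => midpoint_gap_ge0 _ _))).
rewrite lee_fin ler_pdivrMr//; apply: (le_trans gap).
by rewrite mulrA -exprS.
Qed.

Variables (H : nat -> set (T -> R)) (M : R).
Hypotheses (Hdecr : forall n, H n.+1 `<=` H n) (Hne : forall n, H n !=set0)
  (Hint : forall n g, H n g -> integrableR g)
  (Hmid : forall n f g, H n f -> H n g -> H n (fun t => (f t + g t) / 2))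
  (Hbnd : forall n g, H n g -> \int[mu]_t `|g t| <= M).

Let J g := \int[mu]_t smooth_abs (g t).

Let B := fine (mu setT) + M.

Let Hdecr_le m n : (m <= n)%N -> H n `<=` H m.
Proof.
move=> mn; rewrite -(subnK mn); elim: (n - m)%N => // k IH.
by rewrite addSn; exact: subset_trans (@Hdecr _) IH.
Qed.

Let JB n g : H n g -> J g <= B.
Proof.
move=> Hg; apply: (le_trans (Rintegral_smooth_abs_le (Hint Hg))).
by rewrite lerD2l; exact: Hbnd Hg.
Qed.

(** [S] is the limit of the infima of [J] over the decreasing sets [H n].  These
    infima increase to [S], so [J] takes values below [S + e] on every [H m] and
    only values above [S - e] on [H m] for large [m]. *)
Lemma almost_minimizers : exists S : R, forall (e : R) k, 0 < e ->
  exists m g, [/\ (k <= m)%N, H m g, J g <= S + e &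
    forall f, H m f -> S - e <= J f].
Proof.
pose I n := inf [set J g | g in H n].
have J0 g : 0 <= J g by apply: Rintegral_ge0 => t _; exact: smooth_abs_ge0.
have Iinf n : has_inf [set J g | g in H n].
  split; first by have [g Hg] := Hne n; exists (J g), g.
  by exists 0 => _ [g _ <-].
have IJ n g : H n g -> I n <= J g.
  by move=> Hg; apply: ge_inf; [exact: (Iinf n).2|exists g].
have Imono m n : (m <= n)%N -> I m <= I n.
  move=> mn; apply: lb_le_inf; first exact: (Iinf n).1.
  by move=> _ [g /(Hdecr_le mn) Hg <-]; exact: IJ.
have IB n : I n <= B.
  by have [g Hg] := Hne n; exact: le_trans (IJ _ _ Hg) (JB Hg).
have supI : has_sup (range I).
  by split; [exists (I 0), 0|exists B => _ [n _ <-]].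
exists (sup (range I)) => e k e0.
have [_ [n _ <-] Sn] := sup_adherent e0 supI.
pose m := maxn k n.
have Sm : sup (range I) - e < I m.
  by apply: (lt_le_trans Sn); apply: Imono; exact: leq_maxr.
have [_ [g Hg <-] gI] := inf_adherent e0 (Iinf m).
exists m, g; split => //; first exact: leq_maxl.
- apply/ltW/(lt_le_trans gI); rewrite lerD2r.
  by apply: ub_le_sup; [exact: supI.2|exists m].
- by move=> f Hf; apply/ltW/(lt_le_trans Sm)/IJ.
Qed.

(** Take [g k] within [e k] of the limit infimum [S].  The midpoint of [g k] and
    [g k.+1] lies in one of the sets [H m], so [J] is almost at least [S] there;
    hence the integral of the gap is tiny, and the two functions are close
    outside a small set. *)
Lemma rapidly_cauchy_selection : exists (g : nat -> T -> R) (C : R),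
  (forall k, H k (g k)) /\
  forall k, (mu [set t | (2^-1 ^+ k <= `|g k t - g k.+1 t|)%R] <=
             (C * 2^-1 ^+ k)%:E)%E.
Proof.
have [S PS] := almost_minimizers.
pose r k : R := 2^-1 ^+ k.
(* The integral of the gap will be at most [4 * e k], which has to be at most
   the bound [r k ^+ 6 / 6] of [measure_far_le]. *)
pose e k := r k ^+ 6 / 24.
have r0 k : 0 < r k by rewrite exprn_gt0.
have e0 k : 0 < e k by rewrite divr_gt0 ?exprn_gt0.
have /choice[mg Pmg] k : exists mg : nat * (T -> R),
    [/\ (k <= mg.1)%N, H mg.1 mg.2, J mg.2 <= S + e k &
    forall f, H mg.1 f -> S - e k <= J f].
  by have [m [g ?]] := PS _ k (e0 k); exists (m, g).
exists (fun k => (mg k).2), (1 + 2 * B); split.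
  by move=> k; have [km Hg _ _] := Pmg k; exact: Hdecr_le Hg.
move=> k; have [_ Hf fS fm] := Pmg k; have [_ Hg gS gm] := Pmg k.+1.
have fi := Hint Hf; have gi := Hint Hg.
apply: measure_far_le => //; [exact: JB Hf|exact: JB Hg|].
rewrite Rintegral_midpoint_gap//.
have ek : e k.+1 <= e k.
  have rk : r k.+1 <= r k.
    by rewrite /r exprS ler_piMl ?exprn_ge0// invf_le1// ler1n.
  by rewrite ler_pM2r ?invr_gt0// lerXn2r// nnegrE ltW.
suff mid : S - e k <= J (fun t => ((mg k).2 t + (mg k.+1).2 t) / 2).
  move: fS gS mid; rewrite /J -/(r k).
  have -> : r k ^+ 6 / 6 = 4 * e k by rewrite /e; field.
  by move=> ? ? ?; lra.
(* The indices of [g k] and [g k.+1] need not be ordered: the midpoint lies in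
   the set of smaller index. *)
have [m12|m21] := leqP (mg k).1 (mg k.+1).1.
  by apply: fm; apply: Hmid => //; exact: Hdecr_le Hg.
apply: (@le_trans _ _ (S - e k.+1)); first by rewrite lerD2l lerN2.
by apply: gm; apply: Hmid => //; exact: Hdecr_le (ltnW m21) _ Hf.
Qed.

End minimizing_sequence.

Section uniform_positivity.
Context {d : measure_display} {T : measurableType d} {R : realType}.
Variable mu : {finite_measure set T -> \bar R}.
Variables (g : nat -> T -> R) (C : R).
Hypotheses (mg : forall k, measurable_fun setT (g k))
  (g_cauchy : forall k,
    (mu [set t | (2^-1 ^+ k <= `|g k t - g k.+1 t|)%R] <=
     (C * 2^-1 ^+ k)%:E)%E).

Let bad k := [set t | 2^-1 ^+ k <= `|g k t - g k.+1 t|].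

Let measurable_bad k : measurable (bad k).
Proof.
rewrite -[bad k]setTI; apply: measurable_fun_le => //.
by apply: measurableT_comp => //; exact: measurable_funB.
Qed.

Let geometric_tail (c r : R) n : 0 <= c -> 0 <= r ->
  \sum_(0 <= i < n) c * (r * 2^-1 ^+ i) <= 2 * (c * r).
Proof.
move=> c0 r0.
have -> : \sum_(0 <= i < n) c * (r * 2^-1 ^+ i) =
    2 * (c * r) - 2 * (c * r) * 2^-1 ^+ n.
  elim: n => [|n IH]; first by rewrite big_nil expr0 mulr1 subrr.
  by rewrite big_nat_recr//= IH exprS; field.
by rewrite gerBl !mulr_ge0// exprn_ge0.
Qed.

Let measure_bad_tail k0 :
  (mu (\bigcup_j bad (k0 + j)%N) <= (2 * (C * 2^-1 ^+ k0))%:E)%E.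
Proof.
have C0 : 0 <= C.
  have := le_trans (measure_ge0 _ _) (g_cauchy 0).
  by rewrite expr0 mulr1 lee_fin.
apply: le_trans.
  apply: (@measure_sigma_subadditive _ _ _ mu _
    (fun j => bad (k0 + j)%N)) => //.
  exact: bigcupT_measurable.
apply: lime_le; first exact: is_cvg_nneseries.
apply: nearW => n.
apply: (@le_trans _ _ (\sum_(0 <= i < n) (C * (2^-1 ^+ k0 * 2^-1 ^+ i))%:E)%E).
  by apply: lee_sum => i _; rewrite -exprD; exact: g_cauchy.
by rewrite sumEFin lee_fin geometric_tail// exprn_ge0.
Qed.

(** The set where [g k0] is at least [c] has measure at least [b], and only a
    set of measure less than [b] is lost by discarding the points at which some
    later increment is large.  At the remaining points the later [g k] differ
    from [g k0] by at most the sum of a geometric series, which is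
    [2 * 2^-1 ^+ k0 <= c / 2]. *)
Lemma uniformly_positive_set A (c b : R) : measurable A -> 0 < c -> 0 < b ->
  (forall k, (b%:E <= mu (A `&` [set t | (c <= g k t)%R]))%E) ->
  exists B k0, [/\ measurable B, B `<=` A, (0 < mu B)%E &
    forall k t, (k0 <= k)%N -> B t -> c / 2 <= g k t].
Proof.
move=> mA c0 b0 Ab.
have [k0 [k0c k0b]] : exists k0, 2 * 2^-1 ^+ k0 <= c / 2 /\
    2 * (C * 2^-1 ^+ k0) < b.
  have cv : (fun k => 2^-1 ^+ k : R) @ \oo --> (0 : R).
    by apply: cvg_expr; rewrite ger0_norm// invf_lt1// ltr1n.
  have e0 : 0 < Num.min (c / 4) (b / (2 * `|C| + 1)).
    rewrite lt_min !divr_gt0// ltr_wpDl// mulr_ge0//.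
  have [k _ /(_ k (leqnn k))] : \forall k \near \oo,
    2^-1 ^+ k < Num.min (c / 4) (b / (2 * `|C| + 1)) by exact: cvgr_lt cv _ e0.
  rewrite /= lt_min => /andP[kc kb]; exists k; split; first by lra.
  move: kb; rewrite ltr_pdivlMr ?ltr_wpDl ?mulr_ge0// => kb.
  apply: le_lt_trans kb; have r0 : 0 <= 2^-1 ^+ k :> R by rewrite exprn_ge0.
  have := ler_norm C; nra.
pose U := \bigcup_j bad (k0 + j)%N.
pose E := A `&` [set t | c <= g k0 t].
have mU : measurable U by exact: bigcupT_measurable.
have mE : measurable E.
  apply: measurableI => //; rewrite -[X in measurable X]setTI.
  exact: measurable_fun_le.
have mB : measurable (E `\` U) by exact: measurableD.
exists (E `\` U), k0; split => //.
- by move=> t [[]].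
- have EBU : (mu E <= mu (E `\` U) + mu U)%E.
    apply: (@le_trans _ _ (mu (E `\` U `|` U))); last exact: measureU2.
    apply: le_measure; rewrite ?inE//; first exact: measurableU.
    by move=> t Et; have [Ut|Ut] := pselect (U t); [right|left].
  rewrite lt0e measure_ge0 andbT; apply/eqP => B0.
  have : (b%:E <= (2 * (C * 2^-1 ^+ k0))%:E)%E.
    apply: (le_trans (Ab k0)); apply: (le_trans EBU); rewrite B0 add0e.
    exact: measure_bad_tail.
  by rewrite lee_fin leNgt k0b.
- move=> k t k0k [[_ /= cg] nU].
  suff gk j : c - 2 * 2^-1 ^+ k0 * (1 - 2^-1 ^+ j) <= g (k0 + j)%N t.
    have := gk (k - k0)%N; rewrite subnKC// => /(le_trans _); apply.
    have : 0 <= 2^-1 ^+ k0 * 2^-1 ^+ (k - k0) :> R.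
      by rewrite mulr_ge0// exprn_ge0.
    by lra.
  elim: j => [|j IH]; first by rewrite addn0 expr0 subrr mulr0 subr0.
  have : ~ bad (k0 + j)%N t by move=> bt; apply: nU; exists j.
  rewrite /bad/= => /negP; rewrite -ltNge ltr_norml => /andP[_].
  rewrite addnS exprD exprS; lra.
Qed.

End uniform_positivity.

(** * Densities of a vector measure *)

Section scalar_charge.
Context {d : measure_display} {T : measurableType d} {R : realType}.
Context {Z : normedModType R} (nu : set T -> dual Z).
Hypothesis nu_ca : countably_additive nu.

Lemma countably_additive_set0 : nu set0 = 0.
Proof.
have cv : series (fun=> nu set0) @ \oo --> nu set0.
  have := @nu_ca (fun=> set0) (fun=> measurable0) (@trivIset_set0 _ _ _).
  by rewrite bigcup0.
have c0 := cvg_series_cvg_0 (cvgP _ cv).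
by apply: (cvg_unique _ _ c0) => //; exact: cvg_cst.
Qed.

Definition scalar_charge (z : Z) : set T -> \bar R := fun A => (nu A z)%:E.

Lemma scalar_charge0 z : scalar_charge z set0 = 0%E.
Proof. by rewrite /scalar_charge countably_additive_set0. Qed.

Lemma scalar_charge_fin z A : measurable A -> scalar_charge z A \is a fin_num.
Proof. by []. Qed.

Lemma scalar_charge_sigma_additive z : semi_sigma_additive (scalar_charge z).
Proof.
move=> F mF tF mUF.
have -> : (fun n => \sum_(0 <= i < n) scalar_charge z (F i))%E =
    EFin \o (fun n => (\sum_(0 <= i < n) nu (F i)) z).
  apply/funext => n /=; rewrite /scalar_charge sumEFin; congr EFin.
  by rewrite (big_morph (fun f : dual Z => f z : R) (id1 := 0) (op1 := +%R)).
apply: cvg_EFin; first exact: nearW.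
have /cvgrPdist_le cvn := nu_ca mF tF.
apply/cvgrPdist_le => e e0.
have e1 : 0 < e / (1 + `|z|) by rewrite divr_gt0// ltr_wpDr.
near=> n.
rewrite -[X in `|X|]/((nu (\bigcup_i F i) - \sum_(0 <= i < n) nu (F i)) z).
apply: (le_trans (ler_dual_norm _ _)).
apply: (@le_trans _ _ (e / (1 + `|z|) * `|z|)).
  by rewrite ler_wpM2r//; near: n; exact: cvn.
by rewrite mulrAC ler_pdivrMr ?ltr_wpDr// ler_pM2l// lerDr.
Unshelve. all: by end_near. Qed.

End scalar_charge.

Section density.
Context {d : measure_display} {T : measurableType d} {R : realType}.
Variable mu : {finite_measure set T -> \bar R}.
Context {Z : normedModType R} (nu : set T -> dual Z).

(** A relation rather than a chosen representative: densities are unique only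
    almost everywhere, and the relation is stable under combinations. *)
Definition density (z : Z) (g : T -> R) : Prop :=
  mu.-integrable setT (EFin \o g) /\
  forall A, measurable A -> \int[mu]_(t in A) g t = nu A z.

Lemma density_exists z : countably_additive nu -> mu_continuous mu nu ->
  exists g, density z g.
Proof.
move=> nu_ca nu_mu.
pose lam : {charge set T -> \bar R} := HB.pack (scalar_charge nu z)
  (isCharge.Build _ _ _ (scalar_charge nu z) (scalar_charge0 nu_ca z)
    (@scalar_charge_fin _ _ _ _ nu z)
    (@scalar_charge_sigma_additive _ _ _ _ nu nu_ca z)).
have lam_mu : lam `<< mu.
  apply/null_content_dominatesP => A mA muA0.
  suff nuA0 : nu A = 0 by rewrite /lam/= /scalar_charge nuA0.
  apply/eqP; rewrite -normr_le0; apply/ler_addgt0Pl => e e0; rewrite addr0.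
  have [r r0 nuA] := nu_mu _ e0.
  by apply/ltW/nuA => //; rewrite muA0 lte_fin.
have gfin t := Radon_Nikodym_fin_num t lam_mu.
have gE : EFin \o (fine \o Radon_Nikodym lam mu) = Radon_Nikodym lam mu.
  by apply/funext => t /=; rewrite fineK.
exists (fine \o Radon_Nikodym lam mu); split.
  by rewrite gE; exact: Radon_Nikodym_integrable.
move=> A mA; rewrite /Rintegral.
by under eq_integral do rewrite fineK//; rewrite -Radon_Nikodym_integral.
Qed.

Lemma density_midpoint u v f g : density u f -> density v g ->
  density (2^-1 *: u + 2^-1 *: v) (fun t => (f t + g t) / 2).
Proof.
move=> [fi fE] [gi gE]; split; first exact: integrable_midpoint.
move=> A mA; have fA := integrableS measurableT mA (@subsetT _ _) fi.
have gA := integrableS measurableT mA (@subsetT _ _) gi.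
rewrite RintegralZr//; last exact: (integrableD mA fA gA).
by rewrite RintegralD// fE// gE// dual_funD !dual_funZ; lra.
Qed.

Lemma density_L1_le z g M : density z g -> `|z| <= 1 ->
  (forall A, measurable A -> `|nu A| <= M) -> \int[mu]_t `|g t| <= 2 * M.
Proof.
move=> [gi gE] z1 nuM.
have mg : measurable_fun setT g.
  exact/measurable_EFinP/(measurable_int _ gi).
pose P := [set t | 0 <= g t].
have mP : measurable P.
  by rewrite -[P]setTI; apply: measurable_fun_le.
have ia : mu.-integrable setT (EFin \o (fun t => `|g t|)).
  exact: integrable_abse gi.
have nuz A : measurable A -> `|nu A z| <= M.
  by move=> mA; exact: le_trans (ler_dual_norm1 _ z1) (nuM _ mA).
rewrite -(setUv P) Rintegral_setU//; last 3 first.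
- exact: measurableC.
- by rewrite setUv.
- by rewrite disj_set2E setICr.
have -> : \int[mu]_(t in P) `|g t| = nu P z.
  rewrite -gE//; apply: eq_Rintegral => t /set_mem Pt.
  by rewrite ger0_norm.
have -> : \int[mu]_(t in ~` P) `|g t| = - nu (~` P) z.
  rewrite -gE; last exact: measurableC.
  rewrite -mulN1r -RintegralZl//; last 2 first.
  - exact: measurableC.
  - by apply: integrableS gi => //; exact: measurableC.
  apply: eq_Rintegral => t /set_mem/= /negP; rewrite -ltNge => gt0.
  by rewrite ltr0_norm// mulN1r.
have := nuz _ mP; have := nuz _ (measurableC mP).
by rewrite !ler_norml => /andP[? ?] /andP[? ?]; lra.
Qed.

(** Where [g] is below [c] its integral is at most [c * mu T], so a large value
    [nu A z] must come from the part of [A] where [g] is at least [c]. *)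
Lemma density_superlevel z g A c : density z g -> `|z| <= 1 ->
  measurable A -> 0 <= c ->
  nu A z - c * fine (mu setT) <= `|nu (A `&` [set t | c <= g t])|.
Proof.
move=> [gi gE] z1 mA c0.
have mg : measurable_fun setT g.
  exact/measurable_EFinP/(measurable_int _ gi).
pose P := [set t | c <= g t].
have mP : measurable P by rewrite -[P]setTI; apply: measurable_fun_le.
have mAP : measurable (A `&` P) by exact: measurableI.
have mAC : measurable (A `&` ~` P).
  by apply: measurableI => //; exact: measurableC.
have iS B : measurable B -> mu.-integrable B (EFin \o g).
  by move=> mB; exact: (integrableS measurableT).
have low : \int[mu]_(t in A `&` ~` P) g t <= c * fine (mu setT).
  apply: (@le_trans _ _ (\int[mu]_(t in A `&` ~` P) c)).
    apply: le_Rintegral => //; first exact: iS.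
      exact: finite_measure_integrable_cst.
    by move=> t [_ /= /negP]; rewrite -ltNge => /ltW.
  rewrite Rintegral_cst// ler_wpM2l// fine_le ?fin_num_measure//.
  by apply: le_measure; rewrite ?inE.
have split : nu A z = nu (A `&` P) z + \int[mu]_(t in A `&` ~` P) g t.
  rewrite -gE// -{1}(setIT A) -(setUv P) setIUr Rintegral_setU//.
  - by rewrite gE.
  - by apply: iS; exact: measurableU.
  - by rewrite disj_set2E setIACA setICr setI0.
have := ler_dual_norm1 (nu (A `&` P)) z1; rewrite ler_norml => /andP[_ up].
apply: le_trans up; rewrite split; lra.
Qed.

End density.

Section boundedness.
Context {d : measure_display} {T : measurableType d} {R : realType}.
Variable mu : {finite_measure set T -> \bar R}.
Context {Z : completeNormedModType R} (nu : set T -> dual Z).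

(** Each scalar measure is bounded by the integral of the absolute value of its
    density; the Banach-Steinhaus theorem makes the bound uniform over the unit
    ball. *)
Lemma vector_measure_bounded : countably_additive nu -> mu_continuous mu nu ->
  exists M, forall A, measurable A -> `|nu A| <= M.
Proof.
move=> nu_ca nu_mu.
pose F := [set (nu A : Z -> R^o) | A in [set A | measurable A]].
have Fb f : F f -> bounded_fun_norm f /\ linear f.
  move=> [A mA <-]; split; last exact: dual_linear.
  move=> r; exists (`|nu A| * r) => x xr.
  by rewrite (le_trans (ler_dual_norm _ _))// ler_wpM2l// dual_norm_ge0.
have Fp : pointwise_bounded F.
  move=> z; have [g [gi gE]] := density_exists z nu_ca nu_mu.
  exists (\int[mu]_t `|g t|) => _ [A mA <-].
  rewrite -gE//.
  have gA := integrableS measurableT mA (@subsetT _ _) gi.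
  apply: (le_trans (le_normr_Rintegral mA gA)).
  have ia : mu.-integrable setT (EFin \o (fun t => `|g t|)).
    exact: integrable_abse gi.
  rewrite fine_le//; [|exact: integrable_fin_num|].
    apply: integrable_fin_num => //; exact: integrableS ia.
  apply: ge0_subset_integral => //; exact: measurable_int ia.
have [M FM] := Banach_Steinhauss Fb Fp 1.
exists M => A mA; apply: dual_norm_le => z z1; apply: FM => //.
by exists A.
Qed.

End boundedness.

(** * Lower bounds on average ranges and on tail hulls *)

Section average_range_bounds.
Context {d : measure_display} {T : measurableType d} {R : realType}.
Variable mu : {finite_measure set T -> \bar R}.
Context {Z : normedModType R} (nu : set T -> dual Z).

(** The half-space of all [x] with [c <= x z] is convex and weak* closed, so it
    is enough that it contains the averages over subsets of [B]. *)
Lemma average_range_closed_hull_ge z g B (c : R) : density mu nu z g ->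
  measurable B -> (forall t, B t -> c <= g t) ->
  weak_star_closure (convex_hull (average_range mu nu B)) `<=`
  [set x : dual Z | c <= x z].
Proof.
move=> [gi gE] mB cg.
have avg : average_range mu nu B `<=` [set x : dual Z | c <= x z].
  move=> _ [A [mA AB A0] <-] /=.
  have fA0 : 0 < fine (mu A) by rewrite fine_gt0// A0 ltey_eq fin_num_measure.
  suff : c <= (fine (mu A))^-1 * nu A z by [].
  rewrite ler_pdivlMl// mulrC -gE// -Rintegral_cst//.
  apply: le_Rintegral => //.
  - exact: finite_measure_integrable_cst.
  - exact: (integrableS measurableT).
  - by move=> t /AB; exact: cg.
have cvx : convex_hull (average_range mu nu B) `<=`
    [set x : dual Z | c <= x z].
  apply: smallest_sub => //; apply/convex_setP => a b x y a0 b0 ab /= cx cy.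
  suff : c <= a * x z + b * y z by [].
  by rewrite -[c]mul1r -ab mulrDl lerD// ler_wpM2l.
have cl : closed ([set x : dual Z | c <= x z] : set (weak_star Z)).
  have -> : [set x : dual Z | c <= x z] =
      (fun x : weak_star Z => (x : dual Z) z) @^-1` [set r : R | c <= r] by [].
  apply: preimage_closed => [y _|]; last exact: closed_ge.
  exact: weak_star_eval_continuous.
move=> x clx; rewrite ((closure_id _).1 cl).
exact: (@closureS (weak_star Z) _ _ cvx).
Qed.

End average_range_bounds.

Section tail_hulls.
Context {d : measure_display} {T : measurableType d} {R : realType}.
Variable mu : {finite_measure set T -> \bar R}.
Context {Z : completeNormedModType R} (nu : set T -> dual Z).

(** The densities of the elements of the tail hulls satisfy the hypotheses of
    [rapidly_cauchy_selection].  The superlevel sets are bounded below in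
    measure because, by [density_superlevel], [nu] has norm at least [r / 2] on
    each of them, which [mu]-continuity excludes for sets of small measure. *)
Lemma tail_densities_lower_bound (u : nat -> Z) A (r : R) :
  countably_additive nu -> mu_continuous mu nu -> measurable A -> 0 < r ->
  (forall n, `|u n| <= 1) -> (forall n, r <= nu A (u n)) ->
  exists B (c : R) (h : nat -> Z) (g : nat -> T -> R) k0,
    [/\ measurable B, (0 < mu B)%E, 0 < c,
      forall k, tail_hull u k (h k) /\ density mu nu (h k) (g k) &
      forall k t, (k0 <= k)%N -> B t -> c <= g k t].
Proof.
move=> nu_ca nu_mu mA r0 u1 ru.
pose H k := [set g | exists2 z, tail_hull u k z & density mu nu z g].
have hull_sub k : tail_hull u k `<=` [set z | `|z| <= 1 /\ r <= nu A z].
  by apply: tail_hull_sub => //; exact: convex_ball_halfspace.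
have [M nuM] := vector_measure_bounded nu_ca nu_mu.
have [|||||g [C [Hg g_cauchy]]] :=
  @rapidly_cauchy_selection _ _ _ mu H (2 * M).
- by move=> k f [z uz zf]; exists z => //; exact: tail_hullS.
- move=> k; have [g ug] := density_exists (u k) nu_ca nu_mu.
  by exists g, (u k) => //; exact: tail_hull_mem.
- by move=> k f [z _ []].
- move=> k f f' [z uz zf] [z' uz' zf'].
  exists (2^-1 *: z + 2^-1 *: z'); last exact: density_midpoint.
  have /convex_setP := @convex_hull_convex _ Z (u @` [set n | (k <= n)%N]).
  by apply => //; lra.
- by move=> k f [z /hull_sub[z1 _] zf]; exact: density_L1_le zf z1 nuM.
have /choice[h Ph] k : exists z, tail_hull u k z /\ density mu nu z (g k).
  by have [z] := Hg k; exists z.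
pose m := fine (mu setT).
have m0 : 0 <= m by rewrite fine_ge0.
(* Chosen so that [c * m <= r / 2]; the [m + 1] avoids dividing by zero. *)
pose c := r / (2 * (m + 1)).
have c0 : 0 < c by rewrite divr_gt0// mulr_gt0// ltr_wpDl.
have cm : c * m <= r / 2.
  rewrite /c mulrAC ler_pdivrMr ?mulr_gt0 ?ltr_wpDl//.
  have -> : r / 2 * (2 * (m + 1)) = r * m + r by field.
  by rewrite lerDl ltW.
have r2 : 0 < r / 2 by rewrite divr_gt0.
have [b b0 nub] := nu_mu _ r2.
have mg k : measurable_fun setT (g k).
  by have [_ [/(measurable_int _)/measurable_EFinP]] := Ph k.
have Ab k : (b%:E <= mu (A `&` [set t | (c <= g k t)%R]))%E.
  rewrite leNgt; apply/negP => /nub nuAb.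
  have [uh dh] := Ph k; have [h1 rh] := hull_sub _ _ uh.
  have := density_superlevel dh h1 mA (ltW c0).
  apply/negP; rewrite -ltNge; apply: (@lt_le_trans _ _ (r / 2)).
    apply: nuAb; apply: measurableI => //.
    rewrite -[X in measurable X]setTI; exact: measurable_fun_le.
  by rewrite -/m; lra.
have [B [k0 [mB _ B0 Bg]]] := uniformly_positive_set mg g_cauchy mA c0 b0 Ab.
by exists B, (c / 2), h, g, k0; split => //; rewrite divr_gt0.
Qed.

Lemma null_on_tail_hulls (x : dual Z) (u h : nat -> Z) :
  x (u n) @[n --> \oo] --> (0 : R) -> (forall k, tail_hull u k (h k)) ->
  x (h n) @[n --> \oo] --> (0 : R).
Proof.
move=> /cvgr0Pnorm_le xu hu; apply/cvgr0Pnorm_le => e e0.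
have [N _ xN] := xu _ e0; near=> k.
suff sub : tail_hull u k `<=` [set z | `|x z| <= e] by exact: sub (hu k).
apply: tail_hull_sub => [|n kn]; first exact: convex_slab.
by apply: xN => /=; apply: leq_trans kn; near: k; exists N.
Unshelve. all: by end_near. Qed.

End tail_hulls.

Theorem corollary2 (R : realType) (d : measure_display) (T : measurableType d)
    (mu : {finite_measure set T -> \bar R})
    (Z : completeNormedModType R) (X : submodClosed (dual Z))
    (nu : set T -> dual Z) :
  closed [set` X] ->
  norming X ->
  efremov (normed_subspace X) ->
  countably_additive nu ->
  mu_continuous mu nu ->
  (forall A, measurable A -> (0 < mu A)%E ->
    weak_star_closure (convex_hull (average_range mu nu A)) `&` [set` X]
      !=set0) ->
  forall A, measurable A -> nu A \in X.
Proof.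
move=> clX _ efX nu_ca nu_mu avgX A mA.
case: (boolP (nu A \in X)) => // nuAX; exfalso.
have [r r0 far] := far_onT clX nuAX.
have r20 : 0 < r / 2 by rewrite divr_gt0.
have r2 : r / 2 < r by lra.
have [|||z [zC z0]] := @efremov_sequence _ _ X
  [set z | `|z| <= 1 /\ r / 2 <= nu A z] efX.
- by move=> z [].
- exact: convex_ball_halfspace.
- move=> s sX; have [z [z1 rz zs]] := helly sX far r2.
  by exists z => //; split => //; exact: ltW.
have [B [c [h [g [k0 [mB B0 c0 hg cg]]]]]]
  := tail_densities_lower_bound nu_ca nu_mu mA r20
       (fun n => (zC n).1) (fun n => (zC n).2).
have [x [xB xX]] := avgX B mB B0.
have /cvgr0Pnorm_lt/(_ _ c0)[N _ xN] :=
  null_on_tail_hulls (z0 x xX) (fun k => (hg k).1).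
have := xN (maxn N k0) (leq_maxl _ _); apply/negP; rewrite -leNgt.
apply: le_trans (ler_norm _).
apply: (average_range_closed_hull_ge (hg _).2 mB _ xB) => t.
by apply: cg; exact: leq_maxr.
Qed.
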